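(* Let $R$ be a commutative Noetherian ring, let $M$ be a faithful primeful $R$-module, let $X=\mathrm{Spec}(M)$, let $K$ be a submodule of $M$ and set $U=X\setminus V(K)$ and $I=(K:M)$. Then for every $R$-module $N$ there is a unique $R$-isomorphism $f_{K,N}:\mathcal{A}(N,M)(U)\to D_{I}(N)=\varinjlim_n \mathrm{Hom}_R(I^n,N)$ such that $f_{K,N}\circ\epsilon_N^U=\eta_{I,N}$. Moreover, if $h:L\to N$ is a homomorphism of $R$-modules, then $f_{K,N}\circ \mathcal{A}(h,M)(U)=D_{I}(h)\circ f_{K,L}$; hence $f_K:\mathcal{A}(\bullet,M)(U)\to D_{I}(\bullet)$ is a natural equivalence of functors from the category of $R$-modules to itself.
   Context: All rings are commutative with identity, modules unital. For a submodule $L$ of an $R$-module $M$, $(L:M)=\{r\in R\mid rM\subseteq L\}$. A submodule $P$ of $M$ is prime if $P\neq M$ and whenever $rm\in P$ ($r\in R$, $m\in M$) then $r\in (P:M)$ or $m\in P$; then $(P:M)$ is a prime ideal of $R$. $\mathrm{Spec}(M)$ is the set of prime submodules of $M$. $M$ is faithful if $\mathrm{Ann}_R(M)=0$; $M$ is primeful if $M=0$ or the map $\mathrm{Spec}(M)\to\mathrm{Spec}(R/\mathrm{Ann}(M))$, $P\mapsto (P:M)/\mathrm{Ann}(M)$, is surjective. For $L\le M$, $V(L)=\{P\in \mathrm{Spec}(M)\mid (P:M)\supseteq (L:M)\}$; these are the closed sets of the Zariski topology on $X=\mathrm{Spec}(M)$. For $r\in R$, $X_r=X\setminus V(rM)$.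 For open $U\subseteq X$, $\mathrm{Supp}(U)=\{(P:M)\mid P\in U\}$. For an $R$-module $N$, the sheaf $\mathcal{A}(N,M)$ on $X$ is defined by: $\mathcal{A}(N,M)(U)$ is the set of families $(\gamma_{\mathfrak p})_{\mathfrak p\in\mathrm{Supp}(U)}\in\prod_{\mathfrak p\in\mathrm{Supp}(U)}N_{\mathfrak p}$ such that for each $Q\in U$ there exist an open neighbourhood $W\subseteq U$ of $Q$ and $s\in R$, $m\in N$ with $s\notin (P:M)$ and $\gamma_{(P:M)}=m/s\in N_{(P:M)}$ for every $P\in W$ (an $R$-module under componentwise operations; restriction maps restrict families; $\mathcal{A}(N,M)(\emptyset)=0$). The map $\epsilon_N^U:N\to\mathcal{A}(N,M)(U)$ is $n\mapsto (n/1)_{\mathfrak p\in\mathrm{Supp}(U)}$. For an $R$-homomorphism $h:L\to N$, $\mathcal{A}(h,M)(U):\mathcal{A}(L,M)(U)\to\mathcal{A}(N,M)(U)$ sends $(\gamma_{\mathfrak p})$ to $(h_{\mathfrak p}(\gamma_{\mathfrak p}))$, where $h_{\mathfrak p}:L_{\mathfrak p}\to N_{\mathfrak p}$ is the localized map. For an ideal $I$, $D_I(N)=\varinjlim_n\mathrm{Hom}_R(I^n,N)$ is the ideal transform, $D_I(h)$ the induced map, and $\eta_{I,N}:N\to D_I(N)$ is the canonical map sending $n$ to the image of the homomorphism $R\to N$, $r\mapsto rn$. *)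

(* Defs.v *)
From HB Require Import structures.
From mathcomp Require Import all_boot all_algebra.
Set Implicit Arguments. Unset Strict Implicit. Unset Printing Implicit Defensive.
Import GRing.Theory.
Local Open Scope ring_scope.

Section Defs.
Variable R : comPzRingType.

Definition is_ideal (I : R -> Prop) : Prop :=
  I 0 /\ forall (r a b : R), I a -> I b -> I (r * a + b).

Definition is_prime_ideal (p : R -> Prop) : Prop :=
  is_ideal p /\ ~ p 1 /\ forall a b : R, p (a * b) -> p a \/ p b.

Definition noetherian_ring : Prop :=
  forall I : nat -> R -> Prop, (forall n, is_ideal (I n)) ->
    (forall n r, I n r -> I n.+1 r) ->
    exists n0, forall n, (n0 <= n)%N -> forall r, I n r -> I n0 r.

Inductive ideal_mul (J I : R -> Prop) : R -> Prop :=
| ideal_mul0 : ideal_mul J I 0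
| ideal_mulS a b r : J a -> I b -> ideal_mul J I r -> ideal_mul J I (a * b + r).

Fixpoint ideal_pow (I : R -> Prop) (n : nat) : R -> Prop :=
  match n with
  | 0 => fun _ => True
  | n'.+1 => ideal_mul (ideal_pow I n') I
  end.

Variable M : lmodType R.

Definition is_submod (L : M -> Prop) : Prop :=
  L 0 /\ forall (a : R) (x y : M), L x -> L y -> L (a *: x + y).

Definition colon (L : M -> Prop) : R -> Prop := fun r => forall m : M, L (r *: m).

Definition annM : R -> Prop := colon (fun m => m = 0).

Definition faithful_mod : Prop := forall r : R, annM r -> r = 0.

Definition is_prime_submod (P : M -> Prop) : Prop :=
  is_submod P /\ (exists m, ~ P m) /\
  forall (r : R) (m : M), P (r *: m) -> colon P r \/ P m.

Definition SpecM := { P : M -> Prop | is_prime_submod P }.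

Definition pcolon (P : SpecM) : R -> Prop := colon (proj1_sig P).

(* primeful: M = 0 or every prime ideal of R/Ann(M) (i.e. every prime ideal
   of R containing Ann(M)) is (P:M)/Ann(M) for some prime submodule P *)
Definition primeful : Prop :=
  (forall m : M, m = 0) \/
  forall q : R -> Prop, is_prime_ideal q -> (forall r, annM r -> q r) ->
    exists P : SpecM, forall r, pcolon P r <-> q r.

Definition VV (L : M -> Prop) : SpecM -> Prop :=
  fun P => forall r, colon L r -> pcolon P r.

Definition is_open (W : SpecM -> Prop) : Prop :=
  exists L : M -> Prop, is_submod L /\ forall P, W P <-> ~ VV L P.

Definition Supp (U : SpecM -> Prop) : (R -> Prop) -> Prop :=
  fun p => exists P, U P /\ p = pcolon P.

Variable N : lmodType R.

Definition loc_eq (p : R -> Prop) (x y : N * R) : Prop :=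
  exists t : R, ~ p t /\ t *: (y.2 *: x.1 - x.2 *: y.1) = 0.

(* families (gamma_p)_p, each gamma_p given by a representing fraction *)
Definition sfamily := (R -> Prop) -> N * R.

Definition is_section (U : SpecM -> Prop) (g : sfamily) : Prop :=
  (forall p, Supp U p -> ~ p (g p).2) /\
  forall Q, U Q -> exists W : SpecM -> Prop,
    is_open W /\ W Q /\ (forall P, W P -> U P) /\
    exists (s : R) (m : N), forall P, W P ->
      ~ pcolon P s /\ loc_eq (pcolon P) (g (pcolon P)) (m, s).

Definition sec_eq (U : SpecM -> Prop) (g g' : sfamily) : Prop :=
  forall p, Supp U p -> loc_eq p (g p) (g' p).

Definition sec_add (g g' : sfamily) : sfamily :=
  fun p => ((g' p).2 *: (g p).1 + (g p).2 *: (g' p).1, (g p).2 * (g' p).2).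

Definition sec_scale (r : R) (g : sfamily) : sfamily :=
  fun p => (r *: (g p).1, (g p).2).

Definition eps (n : N) : sfamily := fun _ => (n, 1).

(* an element of Hom(I^k, N) is represented by a function R -> N that is
   R-linear on I^k (its values outside I^k are irrelevant) *)
Definition dtrans := (nat * (R -> N))%type.

Definition dvalid (I : R -> Prop) (d : dtrans) : Prop :=
  forall (r a b : R), ideal_pow I d.1 a -> ideal_pow I d.1 b ->
    d.2 (r * a + b) = r *: d.2 a + d.2 b.

Definition deq (I : R -> Prop) (d d' : dtrans) : Prop :=
  exists j, (d.1 <= j)%N /\ (d'.1 <= j)%N /\
    forall a, ideal_pow I j a -> d.2 a = d'.2 a.

Definition dadd (d d' : dtrans) : dtrans :=
  (maxn d.1 d'.1, fun a => d.2 a + d'.2 a).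

Definition dscale (r : R) (d : dtrans) : dtrans := (d.1, fun a => r *: d.2 a).

Definition eta (n : N) : dtrans := (0%N, fun r => r *: n).

Definition iso_prop (K : M -> Prop) (f : sfamily -> dtrans) : Prop :=
  let U := fun P => ~ VV K P in
  let I := colon K in
  (forall g, is_section U g -> dvalid I (f g)) /\
  (forall g g', is_section U g -> is_section U g' -> sec_eq U g g' ->
      deq I (f g) (f g')) /\
  (forall g g', is_section U g -> is_section U g' ->
      deq I (f (sec_add g g')) (dadd (f g) (f g'))) /\
  (forall r g, is_section U g -> deq I (f (sec_scale r g)) (dscale r (f g))) /\
  (forall g g', is_section U g -> is_section U g' -> deq I (f g) (f g') ->
      sec_eq U g g') /\
  (forall d, dvalid I d -> exists g, is_section U g /\ deq I (f g) d) /\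
  (forall n, deq I (f (eps n)) (eta n)).

End Defs.

Definition A_map (R : comPzRingType) (L N : lmodType R) (h : {linear L -> N})
  (g : sfamily L) : sfamily N := fun p => (h (g p).1, (g p).2).

Definition D_map (R : comPzRingType) (L N : lmodType R) (h : {linear L -> N})
  (d : dtrans L) : dtrans N := (d.1, fun a => h (d.2 a)).

(* Main.v *)
(* As M is faithful and primeful, Supp U is the set D(I) of all primes not containing I,
   and A(N,M)(U) is the module of sections over D(I) of the sheaf associated with N.
   A section g corresponds to the class of a linear phi : I^e -> N such that, for every
   b in I^e, b g is the section induced by phi b.  Such a phi is unique up to shrinking I^e,
   since two values differ by an I-power torsion element.  For existence, take by
   noetherianity a maximal ideal J carrying a linear phi with this property: every x in I
   has a power x^k such that x^k g comes from N, and phi extends to J + R x^(i+k) for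
   large i, so J contains a power of each x in I, hence a power of I. *)
Require Import Defs.
From mathcomp Require Import all_boot all_algebra.
From mathcomp Require Import ring.
From Stdlib Require Import ClassicalEpsilon FunctionalExtensionality PropExtensionality.
Set Implicit Arguments. Unset Strict Implicit. Unset Printing Implicit Defensive.
Import GRing.Theory.
Local Open Scope ring_scope.

(** * Ideals of a noetherian ring: maximality, primes and powers *)

Section Ideals.
Variable R : comPzRingType.
Implicit Types (I J A B p q : R -> Prop) (x y r : R).

Lemma ideal_mull I r x : is_ideal I -> I x -> I (r * x).
Proof. by case=> I0 IS Ix; rewrite -[r * x]addr0; apply: IS. Qed.

Lemma ideal_add I x y : is_ideal I -> I x -> I y -> I (x + y).
Proof. by case=> I0 IS Ix Iy; rewrite -[x]mul1r; apply: IS. Qed.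

Definition adjoin A x : R -> Prop := fun y => exists b r, A b /\ y = b + r * x.

Lemma adjoin_ideal A x : is_ideal A -> is_ideal (adjoin A x).
Proof.
move=> idA; split; first by exists 0, 0; split; [case: idA | ring].
move=> r _ _ [b [s [Ab ->]]] [c [t [Ac ->]]].
exists (r * b + c), (r * s + t); split; last by ring.
by case: idA => _; apply.
Qed.

Lemma adjoin_sub A x y : A y -> adjoin A x y.
Proof. by move=> Ay; exists y, 0; split=> //; ring. Qed.

Lemma adjoin_mem A x : is_ideal A -> adjoin A x x.
Proof. by case=> A0 _; exists 0, 1; split=> //; ring. Qed.

(** Otherwise every admissible ideal lies strictly inside another, and choosing successors with
    [epsilon] gives an ascending chain that never stabilises. *)
Lemma noetherian_maximal (C : (R -> Prop) -> Prop) A0 :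
  noetherian_ring R -> is_ideal A0 -> C A0 ->
  exists A, [/\ is_ideal A, C A, forall r, A0 r -> A r &
    forall B, is_ideal B -> C B -> (forall r, A r -> B r) ->
      forall r, B r -> A r].
Proof.
move=> noeth id0 C0; apply: NNPP => nomax.
pose adm A := [/\ is_ideal A, C A & forall r, A0 r -> A r].
pose above A B := adm B /\ (forall r, A r -> B r) /\ exists r, B r /\ ~ A r.
have next A : adm A -> exists B, above A B.
  case=> idA CA sA; apply: NNPP => noB; apply: nomax; exists A; split=> // B idB CB sAB r Br.
  apply: NNPP => nAr; apply: noB; exists B; split; first by split=> // ? /sA /sAB.
  by split=> //; exists r.
pose chain := fix F n := if n is n'.+1 then epsilon (inhabits A0) (above (F n')) else A0.
have admc n : adm (chain n).
  elim: n => [|n IH] /=; first by split.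
  by case: (epsilon_spec (inhabits A0) _ (next _ IH)).
have stepc n := epsilon_spec (inhabits A0) _ (next _ (admc n)).
have [n|n r|n0 stab] := noeth chain; first by have [] := admc n.
  by case: (stepc n) => _ [+ _]; apply.
by case: (stepc n0) => _ [_ [r [Br nr]]]; apply: nr; apply: (stab n0.+1).
Qed.

(** An ideal containing [A] that is maximal among those missing every power of [x] is prime. *)
Lemma exists_prime_avoiding_powers A x :
  noetherian_ring R -> is_ideal A -> (forall n, ~ A (x ^+ n)) ->
  exists q, [/\ is_prime_ideal q, forall r, A r -> q r & ~ q x].
Proof.
move=> noeth idA avA.
have [q [idq avq sAq maxq]] :=
  noetherian_maximal (C := fun B => forall n, ~ B (x ^+ n)) noeth idA avA.
exists q; split=> //; last by have := avq 1; rewrite expr1.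
split=> //; split=> [|a b qab]; first exact: (avq 0).
have meet c : ~ q c -> exists n, adjoin q c (x ^+ n).
  move=> nqc; apply: NNPP => av; apply: nqc; apply: (maxq (adjoin q c)).
  - exact: adjoin_ideal.
  - by move=> n qn; apply: av; exists n.
  - by move=> r; apply: adjoin_sub.
  - exact: adjoin_mem.
apply: NNPP => nqab.
have [|m [u [r [qu em]]]] := meet a; first by move=> ?; apply: nqab; left.
have [|n [v [s [qv en]]]] := meet b; first by move=> ?; apply: nqab; right.
apply: (avq (m + n)%N); rewrite exprD em en.
(* After regrouping, each summand is a multiple of [u], [v] or [a * b], hence in [q], although the
   product is a power of [x]. *)
have -> : (u + r * a) * (v + s * b) = (v + s * b) * u + (r * a * v + r * s * (a * b)) by ring.
by do ![apply: ideal_add => // | apply: ideal_mull => //].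
Qed.

Lemma prime_ideal_neg_mul p a b : is_prime_ideal p -> ~ p a -> ~ p b -> ~ p (a * b).
Proof. by case=> _ [_ pM] na nb /pM []. Qed.

Lemma prime_ideal_neg_exp p a n : is_prime_ideal p -> ~ p a -> ~ p (a ^+ n).
Proof.
move=> pp na; elim: n => [|n IH]; first by case: pp => _ [].
by rewrite exprS; apply: prime_ideal_neg_mul.
Qed.

Lemma prime_ideal_neg_factors p a b : is_prime_ideal p -> ~ p (a * b) -> ~ p a /\ ~ p b.
Proof.
case=> idp _ nab; split=> h; apply: nab; last exact: ideal_mull.
by rewrite mulrC; apply: ideal_mull.
Qed.

Lemma ideal_pow_ideal I n : is_ideal (ideal_pow I n).
Proof.
elim: n => [|n idn] //=; split; first exact: ideal_mul0.
move=> r a b; elim=> {a} [|c d a Ic Id _ IHa] Hb; first by rewrite mulr0 add0r.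
have -> : r * (c * d + a) + b = (r * c) * d + (r * a + b) by ring.
by apply: ideal_mulS (IHa Hb) => //; apply: ideal_mull.
Qed.

Lemma ideal_pow_mul I n a x : ideal_pow I n a -> I x -> ideal_pow I n.+1 (a * x).
Proof. by move=> Ia Ix; rewrite -[a * x]addr0; apply: ideal_mulS => //; apply: ideal_mul0. Qed.

Lemma ideal_pow_anti I m n r : (m <= n)%N -> ideal_pow I n r -> ideal_pow I m r.
Proof.
move/subnK <-; elim: (n - m)%N r => [|k IH] r //=.
elim=> [|a b s Ia Ib _ IHs]; first by case: (ideal_pow_ideal I m).
apply: ideal_add => //; first exact: ideal_pow_ideal.
by rewrite mulrC; apply: ideal_mull; [exact: ideal_pow_ideal | exact: IH].
Qed.

Lemma ideal_pow_exp I x n : I x -> ideal_pow I n (x ^+ n).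
Proof. by move=> Ix; elim: n => [//|n IH]; rewrite exprSr; apply: ideal_pow_mul. Qed.

(* If 1 were not in B = (J : I^e), the stable value of (J : I^n), an element r
   outside B with (B : r) maximal would satisfy r I <= B, hence r in (B : I) = B. *)
Lemma ideal_pow_sub_radical I J :
  noetherian_ring R -> is_ideal J -> (forall x, I x -> exists n, J (x ^+ n)) ->
  exists e, forall a, ideal_pow I e a -> J a.
Proof.
move=> noeth idJ radJ.
pose Q n r := forall a, ideal_pow I n a -> J (r * a).
have idQ n : is_ideal (Q n).
  split=> [a _|r a b Qa Qb c Ic]; first by rewrite mul0r; case: idJ.
  have -> : (r * a + b) * c = r * (a * c) + b * c by ring.
  by case: idJ => _; apply; [apply: Qa | apply: Qb].
have [n r Qr a Ia|e stab] := noeth Q idQ.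
  exact: Qr (ideal_pow_anti (leqnSn n) Ia).
exists e; suff Q1 : Q e 1 by move=> a /Q1; rewrite mul1r.
apply: NNPP => nQ1.
pose ann r y := Q e (y * r).
have idann r : is_ideal (ann r).
  split=> [|s a b Qa Qb]; first by rewrite /ann mul0r; case: (idQ e).
  rewrite /ann; have -> : (s * a + b) * r = s * (a * r) + b * r by ring.
  by case: (idQ e) => _; apply.
have [_ [_ [r [nQr ->]] _ maxr]] := noetherian_maximal
  (C := fun B => exists r, ~ Q e r /\ B = ann r) noeth (idann 1) (ex_intro _ 1 (conj nQ1 erefl)).
(* By stability it is enough that r I^(e+1) lies in J, which follows once r I lies in [Q e]. *)
apply: nQr; apply: (stab e.+1 (leqnSn e)) => a /=.
(* Descent on the exponent: if x^(n+1) r is in [Q e] but x^n r is not, then [ann (x ^+ n * r)]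
   contains both [ann r] and x, so maximality puts x in [ann r]. *)
have QI x : I x -> Q e (x * r).
  move=> Ix; apply: NNPP => nQxr.
  have [n Jn] := radJ _ Ix.
  have : Q e (x ^+ n * r).
    move=> b _; have -> : x ^+ n * r * b = (r * b) * x ^+ n by ring.
    exact: ideal_mull.
  elim: n {Jn} => [|n IH] Qn.
    by apply: nQxr; apply: (ideal_mull _ (idQ e)); rewrite expr0 mul1r in Qn.
  apply: IH; apply: NNPP => nQn.
  apply: nQxr; apply: (maxr (ann (x ^+ n * r))); first exact: idann.
  - by exists (x ^+ n * r).
  - by move=> y Qy; rewrite /ann mulrCA; apply: (ideal_mull _ (idQ e)).
  - by rewrite /ann mulrA -exprS.
elim=> [|c d s Ic Id _ IHs]; first by rewrite mulr0; case: idJ.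
have -> : r * (c * d + s) = (d * r) * c + r * s by ring.
by apply: ideal_add => //; apply: QI.
Qed.

End Ideals.

(** * Equality of elements in the localizations of a module *)

Definition eqat (R : comPzRingType) (N : lmodType R) (p : R -> Prop) (u v : N) : Prop :=
  exists t, ~ p t /\ t *: u = t *: v.

(** Membership in D(I), the complement of V(I) in Spec R. For I = (K:M) it takes the place of the
    open set U of Spec(M). *)
Definition punct (R : comPzRingType) (I : R -> Prop) (p : R -> Prop) : Prop :=
  is_prime_ideal p /\ exists x, I x /\ ~ p x.

Section LocalEquality.
Variables (R : comPzRingType) (N : lmodType R).
Implicit Types (p q : R -> Prop) (u v w : N) (r s x : R).

Lemma scalerC r s u : r *: (s *: u) = s *: (r *: u).
Proof. by rewrite !scalerA mulrC. Qed.

Lemma loc_eqP p u v r s : loc_eq p (u, r) (v, s) <-> eqat p (s *: u) (r *: v).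
Proof.
split=> -[t [nt /= e]]; exists t; split=> //=; last by rewrite scalerBr e subrr.
by apply/eqP; rewrite -subr_eq0 -scalerBr e.
Qed.

Lemma eqat_refl p u : is_prime_ideal p -> eqat p u u.
Proof. by case=> _ [n1 _]; exists 1. Qed.

Lemma eqat_sym p u v : eqat p u v -> eqat p v u.
Proof. by case=> t [nt e]; exists t. Qed.

Lemma eqat_trans p v u w : is_prime_ideal p -> eqat p u v -> eqat p v w -> eqat p u w.
Proof.
move=> pp [s [ns es]] [t [nt et]]; exists (s * t); split; first exact: prime_ideal_neg_mul.
by rewrite -!scalerA -et scalerC es scalerC.
Qed.

Lemma eqat_scale p r u v : eqat p u v -> eqat p (r *: u) (r *: v).
Proof. by case=> t [nt e]; exists t; split=> //; rewrite !(scalerC t) e. Qed.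

Lemma eqat_add p u v u' v' :
  is_prime_ideal p -> eqat p u v -> eqat p u' v' -> eqat p (u + u') (v + v').
Proof.
move=> pp [s [ns es]] [t [nt et]]; exists (s * t); split; first exact: prime_ideal_neg_mul.
by rewrite !scalerDr -!scalerA et !(scalerC s t) es.
Qed.

Lemma eqat_cancel p s u v : is_prime_ideal p -> ~ p s -> eqat p (s *: u) (s *: v) -> eqat p u v.
Proof.
move=> pp ns [t [nt e]]; exists (t * s); split; first exact: prime_ideal_neg_mul.
by rewrite -!scalerA.
Qed.

(** The t with [t *: u = t *: v] form an ideal. If it missed all powers of x, a prime containing it
    and missing x would contradict the equality at that prime. *)
Lemma eqat_exp x u v :
  noetherian_ring R -> (forall q, is_prime_ideal q -> ~ q x -> eqat q u v) ->
  exists e, x ^+ e *: u = x ^+ e *: v.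
Proof.
move=> noeth loc; apply: NNPP => none.
have idA : is_ideal (fun t => t *: u = t *: v).
  split=> [|r a b ea eb]; first by rewrite !scale0r.
  by rewrite !scalerDl -!scalerA ea eb.
have [|q [pq sq nx]] := exists_prime_avoiding_powers (x := x) noeth idA.
  by move=> n e; apply: none; exists n.
by have [t [nt /sq]] := loc q pq nx.
Qed.

End LocalEquality.

(** * Sections over D(I) and their multiples that come from N *)

Section PuncturedSections.
Variables (R : comPzRingType) (I : R -> Prop) (N : lmodType R).
Hypothesis noeth : noetherian_ring R.
Implicit Types (g : sfamily N) (n m : N) (a b r s x : R) (p q : R -> Prop).

(** The section condition read on Spec R, the neighbourhood of p being the part of a basic open set
    D(w) inside D(I). *)
Definition is_punct_section g : Prop :=
  (forall p, punct I p -> ~ p (g p).2) /\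
  forall p, punct I p -> exists w s m, ~ p w /\
    forall q, punct I q -> ~ q w -> ~ q s /\ loc_eq q (g q) (m, s).

(* [a * g = n] as sections over D(I) *)
Definition section_mul g a n : Prop :=
  forall p, punct I p -> eqat p (a *: (g p).1) ((g p).2 *: n).

Lemma loc_eqE p g m s :
  loc_eq p (g p) (m, s) <-> eqat p (s *: (g p).1) ((g p).2 *: m).
Proof. by rewrite -loc_eqP; case: (g p). Qed.

Lemma section_mul_linear g r a b n m :
  section_mul g a n -> section_mul g b m -> section_mul g (r * a + b) (r *: n + m).
Proof.
move=> ga gb p Ip; have [pp _] := Ip.
rewrite scalerDl scalerDr -scalerA (scalerC _ r).
by apply: eqat_add => //; [apply: eqat_scale (ga _ Ip) | apply: gb].
Qed.

Lemma section_mul0 g : section_mul g 0 0.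
Proof. by move=> p [pp _]; rewrite scale0r scaler0; apply: eqat_refl. Qed.

Lemma section_mulM g r a n : section_mul g a n -> section_mul g (r * a) (r *: n).
Proof.
by move=> ga; rewrite -[r * a]addr0 -[r *: n]addr0; exact: section_mul_linear ga (@section_mul0 g).
Qed.

(** Both elements induce the section a g, so they agree at every prime missing x; these primes all
    lie in D(I) because x is in I. *)
Lemma section_mul_unique g a n m x : is_punct_section g ->
  section_mul g a n -> section_mul g a m -> I x -> exists e, x ^+ e *: n = x ^+ e *: m.
Proof.
move=> [den _] gn gm Ix; apply: eqat_exp => // q pq nx.
have Iq : punct I q by split=> //; exists x.
apply: (eqat_cancel pq (den _ Iq)).
exact: eqat_trans (eqat_sym (gn _ Iq)) (gm _ Iq).
Qed.

(* Quasi-compactness of D(I): D(A) with A maximal among the ideals A for which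
   a single exponent works on D(A) already contains D(I). *)
Lemma section_mul_clear g w s m : is_punct_section g ->
  (forall q, punct I q -> ~ q w -> ~ q s /\ loc_eq q (g q) (m, s)) ->
  exists e, section_mul g (w ^+ e * s) (w ^+ e *: m).
Proof.
move=> [den loc] gw.
pose C A := exists e, forall p, punct I p -> (exists a, A a /\ ~ p a) ->
  eqat p ((w ^+ e * s) *: (g p).1) ((g p).2 *: (w ^+ e *: m)).
have id0 : is_ideal (fun r : R => r = 0).
  by split=> // r a b -> ->; rewrite mulr0 addr0.
have C0 : C (fun r => r = 0).
  by exists 0%N => p [[[p0 _] _] _] [a [-> []]].
have [A [idA [e eA] _ maxA]] := noetherian_maximal noeth id0 C0.
exists e => p Ip; apply: (eA _ Ip).
have [pp [x [Ix nx]]] := Ip.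
have [w' [s' [m' [nw' gw']]]] := loc _ Ip.
exists (x * w'); split; last exact: prime_ideal_neg_mul.
(* On D(x w' w), which lies in D(I) because x is in I, both m/s and m'/s' equal g, so a power of x
   w' w equalises the cross products. *)
have [d ed] : exists d, (x * w' * w) ^+ d *: (s *: m') = (x * w' * w) ^+ d *: (s' *: m).
  apply: eqat_exp => // q pq /(prime_ideal_neg_factors pq) [nqxw nqw].
  have [nqx nqw'] := prime_ideal_neg_factors pq nqxw.
  have Iq : punct I q by split=> //; exists x.
  have [_ /loc_eqE g1] := gw _ Iq nqw.
  have [_ /loc_eqE g2] := gw' _ Iq nqw'.
  apply: (eqat_cancel pq (den _ Iq)).
  apply: (eqat_trans (v := s *: (s' *: (g q).1)) pq).
    by rewrite scalerC; apply: eqat_scale (eqat_sym _).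
  by rewrite scalerC [X in eqat q _ X]scalerC; apply: eqat_scale.
apply: (maxA (adjoin A (x * w'))); last exact: adjoin_mem.
- exact: adjoin_ideal.
(* The exponent e settles the primes of D(A). At the others x w' is outside q, and the extra w^d
   supplies the power of w needed to use [ed]. *)
- exists (d + e)%N => q Iq [_ [[b [r [Ab ->]]] nq]]; have [pq _] := Iq.
  have [qb|nqb] := classic (q b); last first.
    have := eA q Iq (ex_intro _ b (conj Ab nqb)).
    move/(eqat_scale (w ^+ d)); rewrite scalerA mulrA -exprD.
    by rewrite (scalerC (w ^+ d)) (scalerA (w ^+ d)) -exprD.
  have nqxw : ~ q (x * w').
    move=> qxw; apply: nq; apply: ideal_add => //; first by case: pq.
    by apply: ideal_mull => //; case: pq.
  have [nqx nqw'] := prime_ideal_neg_factors pq nqxw.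
  have [nqs' /loc_eqE g2] := gw' _ Iq nqw'.
  apply: (eqat_cancel pq nqs').
  apply: (eqat_cancel pq (prime_ideal_neg_exp (n := d) pq nqxw)).
  apply: (eqat_trans (v := (x * w') ^+ d *: ((w ^+ (d + e) * s) *: ((g q).2 *: m'))) pq).
    apply: eqat_scale; rewrite scalerC; apply: eqat_scale; exact: g2.
  have -> : (x * w') ^+ d *: ((w ^+ (d + e) * s) *: ((g q).2 *: m'))
     = (g q).2 *: (w ^+ e *: ((x * w' * w) ^+ d *: (s *: m'))).
    by rewrite !scalerA exprD !exprMn; congr (_ *: _); ring.
  rewrite ed; have -> : (g q).2 *: (w ^+ e *: ((x * w' * w) ^+ d *: (s' *: m)))
     = (x * w') ^+ d *: (s' *: ((g q).2 *: (w ^+ (d + e) *: m))).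
    by rewrite !scalerA exprD !exprMn; congr (_ *: _); ring.
  exact: eqat_refl.
- by move=> r; apply: adjoin_sub.
Qed.

(** The a for which a g comes from N form an ideal. If it missed all powers of x, it would lie in a
    prime q of D(I); but clearing the local fraction of g at q produces an element w^e s of it
    outside q. *)
Lemma section_mul_exp g x : is_punct_section g -> I x ->
  exists k n, section_mul g (x ^+ k) n.
Proof.
move=> gsec Ix; apply: NNPP => none.
have idG : is_ideal (fun a => exists n, section_mul g a n).
  split=> [|r a b [n gn] [m gm]]; first by exists 0; apply: section_mul0.
  by exists (r *: n + m); apply: section_mul_linear.
have [|q [pq sq nx]] := exists_prime_avoiding_powers (x := x) noeth idG.
  by move=> k [n gn]; apply: none; exists k, n.
have Iq : punct I q by split=> //; exists x.
have [w [s [m [nw gw]]]] := gsec.2 _ Iq.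
have [e ge] := section_mul_clear gsec gw.
have [ns _] := gw q Iq nw.
suff : ~ q (w ^+ e * s) by apply; apply: sq; exists (w ^+ e *: m).
by apply: prime_ideal_neg_mul => //; apply: prime_ideal_neg_exp.
Qed.

(** * Linear maps on an ideal that compute multiples of a section *)

Definition linear_on (J : R -> Prop) (phi : R -> N) : Prop :=
  forall r a b, J a -> J b -> phi (r * a + b) = r *: phi a + phi b.

Lemma linear_on_mull J phi r a : is_ideal J -> linear_on J phi -> J a -> phi (r * a) = r *: phi a.
Proof.
move=> [J0 _] lin Ja.
have phi0 : phi 0 = 0.
  by have := congr1 (+%R^~ (- phi 0)) (lin 1 0 0 J0 J0); rewrite mulr0 addr0 scale1r /= subrr addrK.
by rewrite -[r * a]addr0 lin // phi0 addr0.
Qed.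

(* Comparing phi (r x^i a) with r x^i n gives an ascending chain of ideals; past the
   point where it stabilises the two agree, so phi extends by x^i a |-> x^i n. *)
Lemma linear_on_extend g J phi x a n : is_punct_section g -> is_ideal J ->
  linear_on J phi -> (forall b, J b -> section_mul g b (phi b)) ->
  I x -> section_mul g a n ->
  exists i psi, linear_on (adjoin J (x ^+ i * a)) psi /\
    forall b, adjoin J (x ^+ i * a) b -> section_mul g b (psi b).
Proof.
move=> gsec idJ lin gJ Ix ga.
pose B i r := J (r * (x ^+ i * a)) /\ phi (r * (x ^+ i * a)) = r *: (x ^+ i *: n).
have lift i k r : J (r * (x ^+ i * a)) ->
      phi (r * (x ^+ (k + i) * a)) = x ^+ k *: phi (r * (x ^+ i * a)).
  move=> Jr; rewrite -(linear_on_mull _ idJ lin Jr); congr phi; rewrite exprD; ring.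
have liftJ i k r : J (r * (x ^+ i * a)) -> J (r * (x ^+ (k + i) * a)).
  move=> Jr; have -> : r * (x ^+ (k + i) * a) = x ^+ k * (r * (x ^+ i * a)) by rewrite exprD; ring.
  exact: ideal_mull.
have idB i : is_ideal (B i).
  split=> [|r b c [Jb eb] [Jc ec]].
    have J0 : J 0 by case: idJ.
    by split; rewrite mul0r // scale0r -(mul0r 0) (linear_on_mull _ idJ lin J0) scale0r.
  rewrite /B.
  have -> : (r * b + c) * (x ^+ i * a) = r * (b * (x ^+ i * a)) + c * (x ^+ i * a) by ring.
  split; first by case: idJ => _; apply.
  by rewrite lin // eb ec scalerDl scalerA.
have [i r [Jr er]|i stab] := noeth idB.
  split; first exact: (liftJ i 1%N).
  by rewrite (lift i 1%N) // er expr1 exprS -scalerA [RHS]scalerC.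
set c := x ^+ i * a; pose mu := x ^+ i *: n.
have gc : section_mul g c mu by apply: section_mulM.
(* Both values induce the section r c g, so they agree after multiplication by some x^e. This puts r
   in [B (e + i)], hence in [B i] by stability. *)
have agree r : J (r * c) -> phi (r * c) = r *: mu.
  move=> Jr; have [e ee] := section_mul_unique gsec (gJ _ Jr) (section_mulM r gc) Ix.
  suff : B i r by case.
  apply: (stab (e + i)%N (leq_addl _ _)); split; first exact: liftJ.
  by rewrite lift // ee /mu exprD !scalerA; congr (_ *: _); ring.
pose rel b z := exists d r, [/\ J d, b = d + r * c & z = phi d + r *: mu].
(* Two decompositions of b differ by (r - r') c, which lies in J, and there [agree] gives the value
   of [phi]. *)
have rel_unique b z z' : rel b z -> rel b z' -> z = z'.
  move=> [d [r [Jd -> ->]]] [d' [r' [Jd' e ->]]].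
  have e' : (r - r') * c = -1 * d + d'.
    have -> : (r - r') * c = -1 * d + (d + r * c) - r' * c by ring.
    by rewrite e; ring.
  have Jrc : J ((r - r') * c) by rewrite e'; case: idJ => _; apply.
  have := agree _ Jrc; rewrite e' lin // scaleN1r scalerBl => e2.
  by apply/eqP; rewrite addrC -subr_eq addrAC -e2 addrAC addNr add0r.
(* The value outside the adjoined ideal is arbitrary. *)
pose psi b := epsilon (inhabits 0) (rel b).
have psiP b : adjoin J c b -> rel b (psi b).
  move=> [d [r [Jd ->]]]; apply: (epsilon_spec (inhabits 0) (rel _)).
  by exists (phi d + r *: mu), d, r.
exists i, psi; split=> [r b b' Jb Jb'|b Jb].
  apply: (rel_unique (r * b + b')).
    by apply: psiP; case: (adjoin_ideal c idJ) => _; apply.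
  have [d [s [Jd -> ->]]] := psiP _ Jb.
  have [d' [s' [Jd' -> ->]]] := psiP _ Jb'.
  exists (r * d + d'), (r * s + s'); split; first by case: idJ => _; apply.
    ring.
  by rewrite lin // scalerDl !scalerDr scalerA addrACA.
have [d [r [Jd -> ->]]] := psiP _ Jb.
by rewrite addrC [X in section_mul _ _ X]addrC; apply: section_mul_linear => //; apply: gJ.
Qed.

Lemma exists_linear_on_pow g : is_punct_section g ->
  exists e phi, linear_on (ideal_pow I e) phi /\
    forall b, ideal_pow I e b -> section_mul g b (phi b).
Proof.
move=> gsec.
pose C J := exists phi, linear_on J phi /\ forall b, J b -> section_mul g b (phi b).
have id0 : is_ideal (fun r : R => r = 0).
  by split=> // r a b -> ->; rewrite mulr0 addr0.
have C0 : C (fun r => r = 0).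
  exists (fun=> 0); split=> [r a b _ _|b ->]; last exact: section_mul0.
  by rewrite scaler0 addr0.
have [J [idJ [phi [lin gJ]] _ maxJ]] := noetherian_maximal noeth id0 C0.
have [|e eJ] := ideal_pow_sub_radical (I := I) noeth idJ.
  move=> x Ix; have [k [n gk]] := section_mul_exp gsec Ix.
  have [i [psi psiP]] := linear_on_extend gsec idJ lin gJ Ix gk.
  (* Maximality of J absorbs the extension, so x^i x^k is already in J. *)
  exists (i + k)%N; rewrite exprD; apply: maxJ (adjoin_mem _ idJ).
  - exact: adjoin_ideal.
  - by exists psi.
  - by move=> r; apply: adjoin_sub.
by exists e, phi; split=> [r a b /eJ Ja /eJ Jb|b /eJ]; [apply: lin | apply: gJ].
Qed.

(** * Classes in the ideal transform that represent a section *)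

Definition represents g (d : dtrans N) : Prop :=
  exists j, (d.1 <= j)%N /\ forall b, ideal_pow I j b -> section_mul g b (d.2 b).

Lemma dvalid_linear_on (d : dtrans N) j :
  dvalid I d -> (d.1 <= j)%N -> linear_on (ideal_pow I j) d.2.
Proof. by move=> dv dj r a b Ia Ib; apply: dv; apply: ideal_pow_anti dj _. Qed.

Lemma dvalid_mull (d : dtrans N) r a :
  dvalid I d -> ideal_pow I d.1 a -> d.2 (r * a) = r *: d.2 a.
Proof. by move=> dv; apply: linear_on_mull => //; apply: ideal_pow_ideal. Qed.

Lemma deq_sym (d d' : dtrans N) : deq I d d' -> deq I d' d.
Proof. by case=> j [dj [dj' e]]; exists j; split=> //; split=> // a /e. Qed.

Lemma deq_trans (d d' d'' : dtrans N) : deq I d d' -> deq I d' d'' -> deq I d d''.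
Proof.
case=> j [dj [dj' e]] [k [dk [dk' e']]]; exists (maxn j k).
rewrite !leq_max dj dk' orbT; split=> //; split=> // a Ia.
rewrite e ?e' //; first exact: ideal_pow_anti (leq_maxr j k) Ia.
exact: ideal_pow_anti (leq_maxl j k) Ia.
Qed.

(** The elements on which the two maps agree form an ideal. It contains a power of each x in I,
    since both values induce the same multiple of g, and therefore a power of I. *)
Lemma represents_unique g d d' : is_punct_section g -> dvalid I d -> dvalid I d' ->
  represents g d -> represents g d' -> deq I d d'.
Proof.
move=> gsec dv dv' [j [dj gd]] [j' [dj' gd']].
pose k := maxn j j'.
have dk : (d.1 <= k)%N by rewrite leq_max dj.
have dk' : (d'.1 <= k)%N by rewrite leq_max dj' orbT.
have lin := dvalid_linear_on dv dk; have lin' := dvalid_linear_on dv' dk'.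
have idk := ideal_pow_ideal I k.
pose J a := ideal_pow I k a /\ d.2 a = d'.2 a.
have idJ : is_ideal J.
  split=> [|r a b [Ia ea] [Ib eb]].
    have k0 : ideal_pow I k 0 by case: idk.
    split=> //; rewrite -(mul0r 0).
    by rewrite (linear_on_mull _ idk lin k0) (linear_on_mull _ idk lin' k0) !scale0r.
  by split; [case: idk => _; apply | rewrite lin // lin' // ea eb].
have [x Ix|e eJ] := ideal_pow_sub_radical (I := I) noeth idJ.
  have Ik := ideal_pow_exp k Ix.
  have [e ee] := section_mul_unique gsec
    (gd _ (ideal_pow_anti (leq_maxl j j') Ik)) (gd' _ (ideal_pow_anti (leq_maxr j j') Ik)) Ix.
  exists (e + k)%N; rewrite exprD; split; first exact: ideal_mull.
  by rewrite (linear_on_mull _ idk lin) // (linear_on_mull _ idk lin').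
exists (maxn k e); rewrite !(leq_trans _ (leq_maxl k e)) //; split=> //; split=> // a Ia.
by case: (eJ a (ideal_pow_anti (leq_maxr k e) Ia)).
Qed.

(** Equivalent maps need only agree on a high power of I, which is why [represents] allows any
    exponent j beyond the given one. *)
Lemma represents_deq g d d' : represents g d -> deq I d d' -> represents g d'.
Proof.
case=> j [dj gd] [k [dk [dk' e]]]; exists (maxn j k).
rewrite leq_max dk' orbT; split=> // b Ib.
rewrite -e; first by apply: gd; apply: ideal_pow_anti (leq_maxl j k) Ib.
exact: ideal_pow_anti (leq_maxr j k) Ib.
Qed.

(** Injectivity: for x in I outside p, one element of N induces both x^l g and x^l g' for a large l,
    and x^l cancels at p. *)
Lemma represents_sec_eq g g' d d' :
  represents g d -> represents g' d' -> deq I d d' ->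
  forall p, punct I p -> loc_eq p (g p) (g' p).
Proof.
move=> gd g'd' dd'; have [j [dj gj]] := represents_deq gd dd'.
have [k [dk gk]] := g'd' => p Ip; have [pp [x [Ix nx]]] := Ip.
rewrite (surjective_pairing (g' p)); apply/loc_eqE.
have Ijk := ideal_pow_exp (maxn j k) Ix.
apply: (eqat_cancel pp (prime_ideal_neg_exp (n := maxn j k) pp nx)).
rewrite scalerC; apply: (eqat_trans (v := (g' p).2 *: ((g p).2 *: d'.2 (x ^+ maxn j k))) pp).
  by apply: eqat_scale; apply: gj => //; apply: ideal_pow_anti (leq_maxl j k) Ijk.
rewrite scalerC [X in eqat p _ X]scalerC; apply: eqat_scale; apply: eqat_sym.
by apply: gk => //; apply: ideal_pow_anti (leq_maxr j k) Ijk.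
Qed.

Lemma sec_eq_section_mul g g' a n : is_punct_section g ->
  (forall p, punct I p -> loc_eq p (g p) (g' p)) ->
  section_mul g a n -> section_mul g' a n.
Proof.
move=> gsec gg' ga p Ip; have [pp _] := Ip.
apply: (eqat_cancel pp (gsec.1 _ Ip)).
have := gg' p Ip; rewrite (surjective_pairing (g' p)) => /loc_eqE /= e.
apply: (eqat_trans (v := a *: ((g' p).2 *: (g p).1)) pp).
  by rewrite scalerC; apply: eqat_scale (eqat_sym _).
by rewrite scalerC [X in eqat p _ X]scalerC; apply: eqat_scale; apply: ga.
Qed.

Lemma section_mul_sec_add g g' a n n' :
  section_mul g a n -> section_mul g' a n' -> section_mul (sec_add g g') a (n + n').
Proof.
move=> ga ga' p Ip /=; have [pp _] := Ip; rewrite !scalerDr; apply: eqat_add => //.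
  by rewrite scalerC mulrC -scalerA; apply: eqat_scale; apply: ga.
by rewrite scalerC -scalerA; apply: eqat_scale; apply: ga'.
Qed.

Lemma section_mul_sec_scale g r a n : section_mul g a n -> section_mul (sec_scale r g) a (r *: n).
Proof.
by move=> ga p Ip /=; rewrite scalerC [X in eqat p _ X]scalerC; apply: eqat_scale; apply: ga.
Qed.

Lemma section_mul_eps n a : section_mul (eps n) a (a *: n).
Proof. by move=> p [pp _] /=; rewrite scale1r; apply: eqat_refl. Qed.

Lemma punct_section_add g g' :
  is_punct_section g -> is_punct_section g' -> is_punct_section (sec_add g g').
Proof.
move=> [den loc] [den' loc']; split=> p Ip; have [pp _] := Ip.
  by apply: prime_ideal_neg_mul => //; [apply: den | apply: den'].
have [w [s [m [nw gw]]]] := loc p Ip; have [w' [s' [m' [nw' gw']]]] := loc' p Ip.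
exists (w * w'), (s * s'), (s' *: m + s *: m'); split; first exact: prime_ideal_neg_mul.
move=> q Iq; have [pq _] := Iq => /(prime_ideal_neg_factors pq) [nqw nqw'].
have [ns /loc_eqE e] := gw q Iq nqw; have [ns' /loc_eqE e'] := gw' q Iq nqw'.
split; first exact: prime_ideal_neg_mul.
apply/loc_eqE => /=; rewrite !scalerDr; apply: eqat_add => //.
  have := eqat_scale (s' * (g' q).2) e; rewrite !scalerA.
  by congr eqat; congr (_ *: _); ring.
have := eqat_scale (s * (g q).2) e'; rewrite !scalerA.
by congr eqat; congr (_ *: _); ring.
Qed.

Lemma punct_section_scale g r : is_punct_section g -> is_punct_section (sec_scale r g).
Proof.
move=> [den loc]; split=> p Ip; first exact: den.
have [w [s [m [nw gw]]]] := loc p Ip; exists w, s, (r *: m); split=> // q Iq nqw.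
have [ns /loc_eqE e] := gw q Iq nqw; split=> //; apply/loc_eqE => /=.
by rewrite scalerC [X in eqat q _ X]scalerC; apply: eqat_scale.
Qed.

Lemma punct_section_eps n : is_punct_section (eps n).
Proof.
have n1 p : punct I p -> ~ p 1 by case=> -[_ []].
split=> p Ip; first exact: n1.
exists 1, 1, n; split=> [|q Iq _]; first exact: n1.
by split; [exact: n1 | apply/loc_eqE; apply: eqat_refl; case: Iq].
Qed.

Lemma dvalid_add (d d' : dtrans N) : dvalid I d -> dvalid I d' -> dvalid I (dadd d d').
Proof.
move=> dv dv' r a b Ia Ib /=.
rewrite (dvalid_linear_on dv (leq_maxl _ d'.1)) // (dvalid_linear_on dv' (leq_maxr d.1 _)) //.
by rewrite scalerDr addrACA.
Qed.

Lemma dvalid_scale r (d : dtrans N) : dvalid I d -> dvalid I (dscale r d).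
Proof. by move=> dv s a b Ia Ib /=; rewrite dv // scalerDr scalerC. Qed.

Lemma dvalid_eta n : dvalid I (eta n).
Proof. by move=> r a b _ _ /=; rewrite scalerDl scalerA. Qed.

(** Surjectivity: the section takes at p the value phi(a)/a for some a in I^e outside p. The choice
    of a is harmless because a phi(b) = phi(a b) = b phi(a). *)
Lemma exists_section_represented d : dvalid I d ->
  exists g, is_punct_section g /\ represents g d.
Proof.
move=> dv; pose frac p (y : N * R) := exists a, [/\ ideal_pow I d.1 a, ~ p a & y = (d.2 a, a)].
pose g p := epsilon (inhabits (0, 1)) (frac p).
have gP p : punct I p -> frac p (g p).
  move=> [pp [x [Ix nx]]]; apply: (epsilon_spec (inhabits (0, 1))).
  exists (d.2 (x ^+ d.1), x ^+ d.1), (x ^+ d.1); split=> //; first exact: ideal_pow_exp.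
  exact: prime_ideal_neg_exp.
have gmul b : ideal_pow I d.1 b -> section_mul g b (d.2 b).
  move=> Ib p Ip; have [pp _] := Ip; have [a [Ia na ->]] /= := gP p Ip.
  by rewrite -!dvalid_mull // mulrC; apply: eqat_refl.
exists g; split; last by exists d.1.
split=> p Ip; first by have [a [_ na ->]] := gP p Ip.
have [a [Ia na _]] := gP p Ip; exists a, a, (d.2 a); split=> // q Iq nq.
by split=> //; apply/loc_eqE; apply: gmul.
Qed.

End PuncturedSections.

(** * Passage from prime submodules of M to primes of R *)

Section PrimeSubmodules.
Variables (R : comPzRingType) (M : lmodType R).
Hypotheses (faith : faithful_mod M) (prim : primeful M).

Lemma colon_ideal (K : M -> Prop) : is_submod K -> is_ideal (colon K).
Proof.
move=> [K0 KS]; split=> [m|r a b Ka Kb m]; first by rewrite scale0r.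
by rewrite scalerDl -scalerA; apply: KS.
Qed.

Lemma pcolon_prime (P : SpecM M) : is_prime_ideal (pcolon P).
Proof.
case: P => P [Psub [[m nPm] PM]]; split; first exact: colon_ideal.
split=> [P1|a b Pab]; first by apply: (nPm); rewrite -[m]scale1r; apply: P1.
rewrite /pcolon /=; have [|nPb] := classic (colon P b); first by right.
left; have [m0 nm0] := not_all_ex_not _ _ nPb.
by case: (PM a (b *: m0)) => //; rewrite scalerA; apply: Pab.
Qed.

(** Faithfulness makes Ann(M) zero, so every prime of R is reached; if M = 0 it forces 1 = 0 and R
    has no primes. Extensionality yields an equality of predicates, as families are indexed by
    predicates. *)
Lemma pcolon_surj q : is_prime_ideal q -> exists P : SpecM M, pcolon P = q.
Proof.
move=> pq; case: prim => [M0|surj].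
  have := @faith 1 (fun m => M0 _) => e.
  by case: pq => -[q0 _] [[]]; rewrite e.
have [|P eP] := surj q pq; first by move=> r /faith ->; case: pq => -[].
by exists P; apply: functional_extensionality => r; apply: propositional_extensionality.
Qed.

Variable K : M -> Prop.
Let U := fun P : SpecM M => ~ VV K P.

Lemma notVV_punct (L : M -> Prop) (P : SpecM M) : ~ VV L P <-> punct (colon L) (pcolon P).
Proof.
split=> [nV|[_ [x [Lx nx]]] V]; last exact: nx (V x Lx).
split; first exact: pcolon_prime.
have [x nx] := not_all_ex_not _ _ nV.
by exists x; apply: imply_to_and.
Qed.

Lemma Supp_punct p : Supp U p <-> punct (colon K) p.
Proof.
split=> [[P [UP ->]]|Kp]; first exact/notVV_punct.
have [P eP] := pcolon_surj (proj1 Kp).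
by exists P; split=> //; apply/notVV_punct; rewrite eP.
Qed.

Lemma basic_open (w : R) : is_open (fun P : SpecM M => ~ pcolon P w).
Proof.
(* The submodule is wM: (P:M) contains (wM:M) exactly when it contains w. *)
exists (fun y => exists m, y = w *: m); split.
  split; first by exists 0; rewrite scaler0.
  by move=> a _ _ [m ->] [n ->]; exists (a *: m + n); rewrite scalerDr scalerC.
move=> P; split=> nw V; apply: nw; last first.
  by move=> c wc m; have [n ->] := wc m; apply: V.
by apply: V => m; exists m.
Qed.

(** Under P -> (P:M) the complement of V(L) corresponds to D((L:M)), a union of basic sets D(w), so
    neighbourhoods may be shrunk to basic ones. *)
Lemma is_section_punct (N : lmodType R) (g : sfamily N) :
  is_section U g <-> is_punct_section (colon K) g.
Proof.
split=> [[den loc]|[den loc]]; split=> [p|].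
- by move/Supp_punct; apply: den.
- move=> p Kp; have [Q eQ] := pcolon_surj (proj1 Kp).
  have [|W [[L [subL WL]] [WQ [_ [s [m gW]]]]]] := loc Q.
    by apply/notVV_punct; rewrite eQ.
  have /WL/notVV_punct [_ [w [Lw nw]]] := WQ.
  exists w, s, m; rewrite -eQ; split=> // q [pq _] nqw.
  have [P eP] := pcolon_surj pq; rewrite -eP; apply: gW; apply/WL => V.
  by apply: nqw; rewrite -eP; apply: V.
- by move/Supp_punct; apply: den.
- move=> Q /notVV_punct KQ; have [pQ [x [Kx nx]]] := KQ.
  have [w [s [m [nw gw]]]] := loc _ KQ.
  (* The factor x from (K:M) keeps the basic neighbourhood inside U. *)
  have WU (P : SpecM M) : ~ pcolon P (x * w) -> punct (colon K) (pcolon P) /\ ~ pcolon P w.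
    have pP := pcolon_prime P; move/(prime_ideal_neg_factors pP) => [nPx nPw].
    by split=> //; split=> //; exists x.
  exists (fun P => ~ pcolon P (x * w)); split; first exact: basic_open.
  split; first exact: prime_ideal_neg_mul.
  split; first by move=> P /WU [? _]; apply/notVV_punct.
  by exists s, m => P /WU [? ?]; apply: gw.
Qed.

Lemma sec_eq_punct (N : lmodType R) (g g' : sfamily N) :
  sec_eq U g g' <-> forall p, punct (colon K) p -> loc_eq p (g p) (g' p).
Proof. by split=> e p /Supp_punct; apply: e. Qed.

Hypothesis noeth : noetherian_ring R.

(* For x in I some x^i g equals eps n, so x^i (f g) = eta n: compatibility with
   eps alone pins down f. *)
Lemma iso_prop_represents (N : lmodType R) (f : sfamily N -> dtrans N) g :
  iso_prop K f -> is_punct_section (colon K) g -> represents (colon K) g (f g).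
Proof.
move=> [fv [fE [_ [fZ [_ [_ feps]]]]]] gsec.
have secg : is_section U g by apply/is_section_punct.
have fgv := fv g secg.
have idk := ideal_pow_ideal (colon K) (f g).1.
pose J b := ideal_pow (colon K) (f g).1 b /\ section_mul (colon K) g b ((f g).2 b).
have idJ : is_ideal J.
  have k0 : ideal_pow (colon K) (f g).1 0 by case: idk.
  split=> [|r a b [Ia ga] [Ib gb]].
    split=> //; rewrite -[X in (f g).2 X](mul0r 0) (dvalid_mull _ fgv k0) scale0r.
    exact: section_mul0.
  split; first by case: idk => _; apply.
  by rewrite fgv //; apply: section_mul_linear.
have [x Kx|e eJ] := ideal_pow_sub_radical (I := colon K) noeth idJ.
  have [i [n gi]] := section_mul_exp noeth gsec Kx.
  have [j [kj [_ e]]] : deq (colon K) (dscale (x ^+ i) (f g)) (eta n).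
    apply: deq_trans (deq_sym (fZ _ _ secg)) (deq_trans _ (feps n)).
    apply: fE.
    - by apply/is_section_punct; apply: punct_section_scale.
    - by apply/is_section_punct; apply: punct_section_eps.
    - apply/sec_eq_punct => p Kp; apply/loc_eqE => /=.
      by rewrite scale1r; apply: gi.
  have Kj := ideal_pow_exp j Kx; have Kk := ideal_pow_anti kj Kj.
  have {e} := e _ Kj; rewrite /= -(dvalid_mull _ fgv Kk) -exprD => e.
  (* The map [f g] sends x^(i+j) to x^j n, which also induces x^(i+j) g because n induces x^i g. *)
  exists (i + j)%N; rewrite /J e addnC exprD; split.
    by rewrite mulrC; apply: ideal_mull.
  exact: section_mulM.
exists (maxn (f g).1 e); split; first exact: leq_maxl.
by move=> b /(ideal_pow_anti (leq_maxr _ _)) /eJ [].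
Qed.

End PrimeSubmodules.

(** * Functoriality and the natural isomorphism *)

Lemma eqat_map (R : comPzRingType) (L N : lmodType R) (h : {linear L -> N}) (p : R -> Prop) u v :
  eqat p u v -> eqat p (h u) (h v).
Proof. by case=> t [nt e]; exists t; rewrite -!(linearZ_LR h) e. Qed.

Lemma represents_map (R : comPzRingType) (I : R -> Prop) (L N : lmodType R)
  (h : {linear L -> N}) (g : sfamily L) (d : dtrans L) :
  represents I g d -> represents I (A_map h g) (D_map h d).
Proof.
case=> j [dj gd]; exists j; split=> // b Ib p Ip /=.
by rewrite -!(linearZ_LR h); apply: eqat_map; apply: gd.
Qed.

Lemma dvalid_map (R : comPzRingType) (I : R -> Prop) (L N : lmodType R)
  (h : {linear L -> N}) (d : dtrans L) : dvalid I d -> dvalid I (D_map h d).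
Proof. by move=> dv r a b Ia Ib /=; rewrite dv // linearP. Qed.

Lemma punct_section_map (R : comPzRingType) (I : R -> Prop) (L N : lmodType R)
  (h : {linear L -> N}) (g : sfamily L) :
  is_punct_section I g -> is_punct_section I (A_map h g).
Proof.
move=> [den loc]; split=> [p|p Ip]; first exact: den.
have [w [s [m [nw gw]]]] := loc p Ip; exists w, s, (h m); split=> // q Iq nqw.
have [ns /loc_eqE e] := gw q Iq nqw; split=> //; apply/loc_eqE => /=.
by rewrite -!(linearZ_LR h); apply: eqat_map.
Qed.

Theorem theorem3p13 (R : comPzRingType) (M : lmodType R) (K : M -> Prop) :
  noetherian_ring R -> faithful_mod M -> primeful M -> is_submod K ->
  (forall N : lmodType R,
     exists f : sfamily N -> dtrans N,
       iso_prop K f /\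
       (forall f' : sfamily N -> dtrans N, iso_prop K f' ->
          forall g, is_section (fun P => ~ VV K P) g ->
            deq (colon K) (f' g) (f g))) /\
  (forall (L N : lmodType R) (h : {linear L -> N})
          (fL : sfamily L -> dtrans L) (fN : sfamily N -> dtrans N),
     iso_prop K fL -> iso_prop K fN ->
     forall g, is_section (fun P => ~ VV K P) g ->
       deq (colon K) (fN (A_map h g)) (D_map h (fL g))).
Proof.
move=> noeth faith prim subK.
have secP := is_section_punct faith prim K.
have repr := iso_prop_represents faith prim noeth.
split=> [N|L N h fL fN isoL isoN g secg]; last first.
  (* Both sides represent the section [A_map h g], so naturality is uniqueness of
     representatives. *)
  have /secP gsec := secg; have hsec := punct_section_map h gsec.
  apply: (represents_unique noeth hsec).
  - by case: isoN => + _; apply; apply/secP.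
  - by apply: dvalid_map; case: isoL => + _; apply.
  - exact: repr.
  - by apply: represents_map; apply: repr.
pose rel (g : sfamily N) d := dvalid (colon K) d /\ represents (colon K) g d.
(* Any representative will do; [eta 0] only shows that the type is inhabited. *)
pose f g := epsilon (inhabits (eta 0)) (rel g).
have fP g : is_punct_section (colon K) g -> rel g (f g).
  move=> gsec; apply: (epsilon_spec (inhabits (eta 0)) (rel g)).
  have [e [phi [lin gphi]]] := exists_linear_on_pow noeth gsec.
  by exists (e, phi); split=> //; exists e.
(* Each [deq] to be proved compares two representatives of one section; injectivity is
   [represents_sec_eq]. *)
have isof : iso_prop K f.
  split; first by move=> g /secP /fP [].
  split.
    move=> g g' /secP gsec /secP gsec' /(sec_eq_punct faith prim K) e.
    have [v [j [dj r]]] := fP g gsec; have [v' r'] := fP g' gsec'.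
    apply: (represents_unique noeth gsec') => //; exists j; split=> // b Ib.
    by apply: sec_eq_section_mul (r b Ib).
  split.
    move=> g g' /secP gsec /secP gsec'; have addsec := punct_section_add gsec gsec'.
    have [v [j [dj r]]] := fP g gsec; have [v' [j' [dj' r']]] := fP g' gsec'.
    have [va ra] := fP _ addsec.
    apply: (represents_unique noeth addsec) => //; first exact: dvalid_add.
    exists (maxn j j'); split=> [|b Ib /=].
      by rewrite geq_max !leq_max dj dj' orbT.
    apply: section_mul_sec_add.
      by apply: r; apply: ideal_pow_anti (leq_maxl j j') Ib.
    by apply: r'; apply: ideal_pow_anti (leq_maxr j j') Ib.
  split.
    move=> r g /secP gsec; have ssec := punct_section_scale r gsec.
    have [v [j [dj gj]]] := fP g gsec; have [vs rs] := fP _ ssec.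
    apply: (represents_unique noeth ssec) => //; first exact: dvalid_scale.
    by exists j; split=> // b Ib; apply: section_mul_sec_scale; apply: gj.
  split.
    move=> g g' /secP gsec /secP gsec' e; apply/(sec_eq_punct faith prim K).
    by apply: represents_sec_eq e; [case: (fP g gsec) | case: (fP g' gsec')].
  split.
    move=> d dv; have [g [gsec gd]] := exists_section_represented dv.
    have [v r] := fP g gsec; exists g; split; first exact/secP.
    exact: (represents_unique noeth gsec).
  move=> n; have nsec := punct_section_eps (colon K) n.
  have [v r] := fP _ nsec.
  apply: (represents_unique noeth nsec) => //; first exact: dvalid_eta.
  by exists 0%N; split=> // b _; apply: section_mul_eps.
(* Any other such isomorphism also sends g to a representative of g, hence to the same class. *)
exists f; split=> // f' isof' g /secP gsec.
have [v r] := fP g gsec.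
apply: (represents_unique noeth gsec) => //; last exact: repr.
by case: isof' => + _; apply; apply/secP.
Qed.
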